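(* Let $\Gamma_0\subset\Gamma_1\subset\Gamma_2$ be elliptic graphs such that for $k\in\{0,1\}$, $\Gamma_{k+1}$ is obtained from $\Gamma_k$ by attaching finitely many (at least one) new vertices, each joined by a single edge only to one fixed end-vertex of $\Gamma_k$. Let $\check\ell\in Supp(\check P_0^{\Gamma_0})$ and assume $\check\pi_{(\Gamma_0,\Gamma_2)}^{-1}(\check\ell)\neq\emptyset$. Let $NE$ be the set of those $\check\ell_1\in\check\pi^{-1}_{(\Gamma_0,\Gamma_1)}(\check\ell)$ with $\check\pi^{-1}_{(\Gamma_1,\Gamma_2)}(\check\ell_1)=\emptyset$. Then $$\sum_{\check\ell_1\in NE}z^{\Gamma_1}(\check\ell_1)=0.$$
   Context: For a decorated tree $G$ (vertex set $\mathcal V(G)$, integer decorations $e_v$, genera zero, negative definite form on $L(G)=\mathbb Z\langle E_v\rangle$ with $(E_v,E_v)=e_v$, $(E_v,E_w)=1$ for adjacent $v\ne w$, $0$ otherwise) let $L'(G)$ be its dual lattice, $E_v^*$ with $(E_v^*,E_w)=-\delta_{vw}$, $\delta_v$ the valency, $E^G=\sum E_v$, $Z_K^G$ with $(Z_K^G,E_v)=e_v+2$, $\chi(l')=-(l',l'-Z_K^G)/2$; $\ge$ coordinatewise, $\prec$ strict in all coordinates, $l>0$ if $l\ge0,l\ne0$. $Z^G(\mathbf t)=\sum z^G(l')\mathbf t^{l'}$ is the Taylor expansion at $0$ of $\prod_v(1-\mathbf t^{E_v^*})^{\delta_v-2}$. $Supp(\check P_0^G)=\{Z^G_K-E^G-\ell:\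 \ell\in L(G),\ \ell\not\prec0,\ z^G(Z^G_K-E^G-\ell)\ne0\}$. $G$ is elliptic if $e_v\le-2$ for all $v$ and $\min_{l\in L(G),l>0}\chi(l)=0$. An end-vertex is a vertex of valency 1. For connected full subgraphs $\Gamma'\subset\Gamma''$, $\check\pi_{(\Gamma',\Gamma'')}(x)=Z_K^{\Gamma'}-E^{\Gamma'}-(Z_K^{\Gamma''}-E^{\Gamma''}-x)|_{\Gamma'}$ (restriction of coefficients to vertices of $\Gamma'$), and $\check\pi^{-1}_{(\Gamma',\Gamma'')}(y)=\{x\in Supp(\check P_0^{\Gamma''}):\check\pi_{(\Gamma',\Gamma'')}(x)=y\}$. *)

(* Defs.v *)
From HB Require Import structures.
From mathcomp Require Import all_boot all_order all_algebra.
From Stdlib Require Import ClassicalEpsilon.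
Set Implicit Arguments.
Unset Strict Implicit.
Unset Printing Implicit Defensive.
Import Order.TTheory GRing.Theory Num.Theory.
Local Open Scope ring_scope.

(* Ambient finite graph: vertex type T, adjacency adj (symmetric, irreflexive
   in the theorem), integer decorations e.  A decorated graph is the full
   subgraph induced on a vertex set S : {set T}.  Elements of L(G) (x) Q are
   vectors T -> rat, coordinates in the basis E_v, supported on S. *)
Section Graph.
Variables (T : finType) (adj : rel T) (e : T -> int).

Definition vec := {ffun T -> rat}.

Definition Mform (v w : T) : rat :=
  if v == w then (e v)%:~R else if adj v w then 1 else 0.

Definition supported (S : {set T}) (x : vec) := forall v, v \notin S -> x v = 0.

Definition pairE (S : {set T}) (x : vec) (v : T) : rat :=
  \sum_(w in S) x w * Mform w v.

Definition form (S : {set T}) (x y : vec) : rat :=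
  \sum_(v in S) \sum_(w in S) x v * y w * Mform v w.

Definition valency (S : {set T}) (v : T) : nat := #|[set w in S | adj v w]|.

Definition Evec (S : {set T}) : vec := [ffun v => if v \in S then 1 else 0].

Definition restrict (S : {set T}) (x : vec) : vec :=
  [ffun v => if v \in S then x v else 0].

(* Z_K^G : (Z_K, E_v) = e_v + 2 (unique under negative definiteness) *)
Definition is_ZK (S : {set T}) (zk : vec) :=
  supported S zk /\ forall v, v \in S -> pairE S zk v = (e v + 2)%:~R.
Definition ZK (S : {set T}) : vec := epsilon (inhabits (0 : vec)) (is_ZK S).

Definition chi (S : {set T}) (l : vec) : rat := - (form S l (l - ZK S)) / 2.

Definition inL (S : {set T}) (l : vec) := supported S l /\ forall v, l v \is a Num.int.
Definition posL (S : {set T}) (l : vec) := (forall v, v \in S -> 0 <= l v) /\ l != 0.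
Definition strict_neg (S : {set T}) (l : vec) := forall v, v \in S -> l v < 0.

Definition neg_def (S : {set T}) :=
  forall x, supported S x -> x != 0 -> form S x x < 0.

Definition connectedS (S : {set T}) :=
  forall u v, u \in S -> v \in S ->
    connect (fun a b => [&& a \in S, b \in S & adj a b]) u v.

(* tree: nonempty, connected, #edges = #vertices - 1 (edges counted as
   ordered pairs, hence the factor 2) *)
Definition is_tree (S : {set T}) :=
  [/\ S != set0, connectedS S &
    #|[set p : T * T | [&& p.1 \in S, p.2 \in S & adj p.1 p.2]]| = (2 * (#|S| - 1))%N].

Definition elliptic (S : {set T}) :=
  [/\ is_tree S, neg_def S, (forall v, v \in S -> e v <= -2),
      (exists l, [/\ inL S l, posL S l & chi S l = 0]) &
      (forall l, inL S l -> posL S l -> 0 <= chi S l)].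

(* coefficient of x^n in (1 - x)^k, k : int *)
Definition coefk (k : int) (n : nat) : int :=
  match k with
  | Posz m => (-1) ^+ n * ('C(m, n))%:Z
  | Negz m => ('C(m + n, n))%:Z
  end.

(* z^G(x): coefficient of t^x in prod_v (1 - t^{E_v^*})^(delta_v - 2).
   Since the E_v^* form a Q-basis, t^x = prod_v (t^{E_v^*})^{n_v} with
   n_v = -(x, E_v); the coefficient is nonzero only if all n_v in N. *)
Definition zcoef (S : {set T}) (x : vec) : int :=
  if [forall v in S, (denq (pairE S x v) == 1) && (numq (pairE S x v) <= 0)]
  then \prod_(v in S) coefk ((valency S v)%:Z - 2) `|numq (pairE S x v)|%N
  else 0.

Definition Supp (S : {set T}) (x : vec) :=
  [/\ supported S x,
      (exists l, [/\ inL S l, ~ strict_neg S l & x = ZK S - Evec S - l]) &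
      zcoef S x != 0].

Definition piproj (S' S'' : {set T}) (x : vec) : vec :=
  ZK S' - Evec S' - restrict S' (ZK S'' - Evec S'' - x).

Definition piinv (S' S'' : {set T}) (y x : vec) := Supp S'' x /\ piproj S' S'' x = y.

Definition attached (Sk Sk1 : {set T}) :=
  Sk \proper Sk1 /\
  exists u, [/\ u \in Sk, valency Sk u = 1%N &
    forall w, w \in Sk1 :\: Sk -> [set x in Sk1 | adj w x] = [set u]].

End Graph.

(* Main.v *)
Require Import Defs.
From HB Require Import structures.
From mathcomp Require Import all_boot all_order all_algebra.
From mathcomp Require Import zify ring lra.
From Stdlib Require Import ClassicalEpsilon.
Set Implicit Arguments.
Unset Strict Implicit.
Unset Printing Implicit Defensive.
Import Order.TTheory GRing.Theory Num.Theory.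
Local Open Scope ring_scope.

(** Write a support point as Z_K - E - l with l integral, so that the projections
    become restrictions of l.  In the coordinates of l the series factors over
    the vertices: at a leaf w attached to u the factor is the condition
    l_w <= floor((l_u - 1) / -e_w), and at u, which gets m leaves, it is
    (-1)^N C(m-1, N) with N affine of slope 1 in each new l_w.

    If the end-vertex u1 used in the second step already lies in the first graph,
    extendability of l_1 depends only on l_0, and nothing fails to extend.
    Otherwise u1 is one of the m new leaves and l_1 extends iff F(y) >= 0, where
    y = l_{u1} and F(y) = e_{u1} y + l_u - 1 + sum_w ceil(y / -e_w), w running
    over the leaves at u1.  For fixed y, summing over the other m - 1 new
    coordinates multiplies (1-X)^(m-1) by (1-X)^-(m-1), so only the smallest y
    allowed by N >= 0 contributes.  Ellipticity bounds the number of leaves at u1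
    by -e_{u1}, hence F is nonincreasing; as F >= 0 somewhere in the allowed
    range, F >= 0 at that smallest y, which thus does not occur in the sum. *)

(** * Lattice and Riemann-Roch function *)

Section Lattice.
Variables (T : finType) (adj : rel T) (e : T -> int).
Hypotheses (adjC : symmetric adj) (adjI : irreflexive adj).
Implicit Types (S : {set T}) (x y : vec T) (v w : T).

Local Notation pairE := (Defs.pairE adj e).
Local Notation form := (Defs.form adj e).
Local Notation chi := (Defs.chi adj e).
Local Notation ZK := (Defs.ZK adj e).

Lemma MformC v w : Mform adj e v w = Mform adj e w v.
Proof. by rewrite /Mform eq_sym adjC; case: eqP => // ->. Qed.

Lemma pairE_linear S v (a : rat) (x y : {ffun T -> rat^o}) :
  pairE S (a *: x + y) v = a * pairE S x v + pairE S y v.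
Proof.
rewrite /Defs.pairE mulr_sumr -big_split; apply: eq_bigr => w _ /=.
by rewrite !ffunE /= mulrDl mulrA.
Qed.

Lemma pairED S v x y : pairE S (x + y) v = pairE S x v + pairE S y v.
Proof. by have := pairE_linear S v 1 x y; rewrite scale1r mul1r. Qed.

Lemma pairEN S v x : pairE S (- x) v = - pairE S x v.
Proof.
by rewrite /Defs.pairE -sumrN; apply: eq_bigr => w _; rewrite ffunE mulNr.
Qed.

Lemma pairEB S v x y : pairE S (x - y) v = pairE S x v - pairE S y v.
Proof. by rewrite pairED pairEN. Qed.

Lemma sum_supported S S' x (F : T -> rat) : S \subset S' -> supported S x ->
  \sum_(v in S') x v * F v = \sum_(v in S) x v * F v.
Proof.
move=> sub sx; rewrite (big_setID S) /= (setIidPr sub) [X in _ + X]big1 ?addr0 //.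
by move=> v /setDP[_ /sx ->]; rewrite mul0r.
Qed.

Lemma pairE_supported S S' x v : S \subset S' -> supported S x ->
  pairE S' x v = pairE S x v.
Proof. exact: sum_supported. Qed.

Lemma formE S x y : form S x y = \sum_(v in S) x v * pairE S y v.
Proof.
apply: eq_bigr => v _; rewrite mulr_sumr; apply: eq_bigr => w _.
by rewrite mulrA MformC.
Qed.

Lemma sum_pairEC S x y :
  \sum_(v in S) x v * pairE S y v = \sum_(v in S) y v * pairE S x v.
Proof.
rewrite -!formE /Defs.form exchange_big; apply: eq_bigr => v _.
by apply: eq_bigr => w _; rewrite MformC [x w * _]mulrC.
Qed.

(** [ZK] comes from a choice operator, so existence has to be shown: by negative definiteness the
    pairing, extended by the identity off [S], is an injective endomorphism, hence bijective in
    finite dimension. *)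
Lemma ZKP S : neg_def adj e S -> is_ZK adj e S (ZK S).
Proof.
move=> nd; apply: epsilon_spec.
pose f (x : {ffun T -> rat^o}) : {ffun T -> rat^o} := [ffun v => if v \in S then pairE S x v else x v].
have f_lin : linear f.
  move=> a x y; apply/ffunP => v; rewrite !ffunE.
  by case: ifP => _ //; rewrite pairE_linear.
pose flM := GRing.isLinear.Build _ _ _ _ f f_lin.
pose fl : {linear {ffun T -> rat^o} -> {ffun T -> rat^o}} := HB.pack f flM.
pose h := linfun fl.
have h0 : lker h == 0%VS.
  apply/lker0P => x y /eqP; rewrite -subr_eq0 -linearB => /eqP hxy.
  apply/eqP; rewrite -subr_eq0; apply/negPn/negP => nz.
  have hf z : h z = f z by rewrite lfunE.
  have fz v : f (x - y) v = 0 by rewrite -hf hxy ffunE.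
  have sz : supported S (x - y).
    by move=> v vS; move: (fz v); rewrite ffunE (negbTE vS).
  have := nd _ sz nz; rewrite formE big1 ?ltxx // => v vS.
  by move: (fz v); rewrite ffunE vS => ->; rewrite mulr0.
pose t : {ffun T -> rat^o} := [ffun v => if v \in S then (e v + 2)%:~R else 0].
exists (h^-1%VF t); have ht : f (h^-1%VF t) = t.
  by have := lker0_lfunVK h0 t; rewrite [h _]lfunE.
split=> v vS; move/ffunP/(_ v): ht; rewrite !ffunE.
  by rewrite (negbTE vS).
by rewrite vS.
Qed.

Lemma chiE S x : neg_def adj e S ->
  chi S x = - (\sum_(v in S) x v * (pairE S x v - (e v + 2)%:~R)) / 2.
Proof.
move=> /ZKP[_ zk]; rewrite /Defs.chi formE; congr (- _ / _).
by apply: eq_bigr => v vS; rewrite pairEB zk.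
Qed.

Lemma chiD S x y : neg_def adj e S ->
  chi S (x + y) = chi S x + chi S y - \sum_(v in S) y v * pairE S x v.
Proof.
move=> nd; rewrite !chiE //.
have -> : \sum_(v in S) (x + y) v * (pairE S (x + y) v - (e v + 2)%:~R) =
  \sum_(v in S) x v * (pairE S x v - (e v + 2)%:~R) +
  \sum_(v in S) y v * (pairE S y v - (e v + 2)%:~R) +
  (\sum_(v in S) x v * pairE S y v + \sum_(v in S) y v * pairE S x v).
  rewrite -!big_split; apply: eq_bigr => v _ /=.
  by rewrite pairED ffunE /=; ring.
by rewrite (sum_pairEC S x y); field.
Qed.

Lemma chi_supported S S' x : neg_def adj e S -> neg_def adj e S' ->
  S \subset S' -> supported S x -> chi S' x = chi S x.
Proof.
move=> nd nd' sub sx; rewrite !chiE // (sum_supported _ sub sx).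
by congr (- _ / _); apply: eq_bigr => v _; rewrite (pairE_supported _ sub sx).
Qed.

Definition delta v : vec T := [ffun w => (w == v)%:R].

Lemma pairE_delta S v w : v \in S -> pairE S (delta v) w = Mform adj e v w.
Proof.
move=> vS; rewrite /Defs.pairE (bigD1 v) //= ffunE eqxx mul1r big1 ?addr0 //.
by move=> u /andP[_ /negbTE nu]; rewrite ffunE nu mul0r.
Qed.

Lemma chi_delta S v : neg_def adj e S -> v \in S -> chi S (delta v) = 1.
Proof.
move=> nd vS; rewrite chiE // (bigD1 v) //= pairE_delta // ffunE eqxx big1; last first.
  by move=> u /andP[_ /negbTE nu]; rewrite ffunE nu mul0r.
by rewrite /Mform eqxx !rmorphD /=; field.
Qed.

Lemma chiD_delta S x v : neg_def adj e S -> v \in S ->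
  chi S (x + delta v) = chi S x + 1 - pairE S x v.
Proof.
move=> nd vS; rewrite chiD // chi_delta //; congr (_ - _).
rewrite (bigD1 v) //= ffunE eqxx mul1r big1 ?addr0 //.
by move=> u /andP[_ /negbTE nu]; rewrite ffunE nu mul0r.
Qed.

(* Laufer's computation sequence: crossing an edge into a vertex of
   multiplicity 0 does not increase chi. *)
Lemma chi_le0_at S x u : neg_def adj e S -> connectedS adj S ->
  inL S x -> posL S x -> chi S x <= 0 -> u \in S ->
  exists y, [/\ inL S y, (forall v, v \in S -> 0 <= y v), chi S y <= 0 & 1 <= y u].
Proof.
move=> nd conn [sx ix] [px nz] cx uS.
have [v0 v0S xv0] : exists2 v, v \in S & x v != 0.
  have /existsP[v xv] : [exists v, x v != 0].
    apply: contraNT nz => /existsPn x0; apply/eqP/ffunP => v.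
    by rewrite ffunE; apply/eqP; have := x0 v; rewrite negbK.
  exists v => //; apply/negPn/negP => /sx xv'; by rewrite xv' eqxx in xv.
have ge1 (y : vec T) w : y w \is a Num.int -> 0 <= y w -> y w != 0 -> 1 <= y w.
  move=> /intrP[n ->]; rewrite ler0z ler1z intr_eq0; lia.
have /connectP[p pp ->] := conn v0 u v0S uS.
elim/last_ind: p pp => [_|p w IH] /=.
  by exists x; split=> //; apply: ge1; rewrite ?ix ?px.
rewrite rcons_path last_rcons => /andP[pp /and3P[aS wS adw]].
have [y [[sy iy] py cy ya]] := IH pp.
have [yw|yw] := eqVneq (y w) 0; last first.
  by exists y; split=> //; apply: ge1; rewrite ?iy ?py.
exists (y + delta w); split.
- split=> v; last by rewrite !ffunE rpredD ?iy ?natr_int.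
  move=> vS; rewrite !ffunE sy // add0r; case: eqP => // vw.
  by rewrite vw wS in vS.
- by move=> v vS; rewrite !ffunE addr_ge0 ?py ?ler0n.
(* Adding E_w changes chi by 1 - (y, E_w). As y_w = 0, the decoration e_w does not enter, and (y,
   E_w) is at least the multiplicity of the preceding vertex. *)
- rewrite chiD_delta //; suff : 1 <= pairE S y w by lra.
  rewrite /Defs.pairE (bigD1 (last v0 p)) //= /Mform adw.
  have -> : (last v0 p == w) = false.
    by apply/eqP => aw; rewrite aw adjI in adw.
  rewrite mulr1 (le_trans ya) // lerDl sumr_ge0 // => v /andP[vS _].
  have [-> |_] := eqVneq v w; first by rewrite yw mul0r.
  by case: ifP; rewrite ?mulr0 ?mulr1 ?py.
- by rewrite !ffunE yw eqxx add0r.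
Qed.

End Lattice.

(** * Support points in integral coordinates *)

Lemma leaf_ge0 (a y z : int) : a <= -2 ->
  (0 <= a * y + z - 1) = (y <= (z - 1) %/ - a)%Z.
Proof. by move=> a2; rewrite lez_divRL; lia. Qed.

Section Encoding.
Variables (T : finType) (adj : rel T) (e : T -> int).
Hypotheses (adjC : symmetric adj) (adjI : irreflexive adj).
Implicit Types (S : {set T}) (x : vec T) (v w u : T) (g h : T -> int).

Local Notation pairE := (Defs.pairE adj e).
Local Notation ZK := (Defs.ZK adj e).
Local Notation Supp := (Defs.Supp adj e).
Local Notation piproj := (Defs.piproj adj e).
Local Notation piinv := (Defs.piinv adj e).
Local Notation zcoef := (Defs.zcoef adj e).
Local Notation val S v := ((valency adj S v)%:Z).

Definition Mint v w : int := if v == w then e v else (adj v w)%:R.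

(* The exponent of t^{E_v^*} in t^x for x = Z_K - E - sum_v g_v E_v. *)
Definition expo S g v : int := \sum_(w in S) g w * Mint w v + val S v - 2.

(** Extending [coefk] by zero to negative exponents moves the sign test of [zcoef] into the single
    factors. *)
Definition coefz (k n : int) : int := if 0 <= n then coefk k `|n|%N else 0.

Definition weight S g : int := \prod_(v in S) coefz (val S v - 2) (expo S g v).

(** Cutting [g] off outside [S] lets one function give points over all the nested graphs. *)
Definition intvec S g : vec T := [ffun v => if v \in S then (g v)%:~R else 0].

Definition dualvec S g : vec T := ZK S - Evec S - intvec S g.

Lemma Mform_int v w : Mform adj e v w = (Mint v w)%:~R.
Proof. by rewrite /Mform /Mint; case: eqP => // _; case: (adj v w). Qed.

Lemma eq_expo S g h v : {in S, g =1 h} -> expo S g v = expo S h v.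
Proof.
by move=> gh; congr (_ + _ - _); apply: eq_bigr => w wS; rewrite gh.
Qed.

Lemma eq_weight S g h : {in S, g =1 h} -> weight S g = weight S h.
Proof. by move=> gh; apply: eq_bigr => v _; rewrite (eq_expo _ gh). Qed.

Lemma dualvecP S g h : dualvec S g = dualvec S h <-> {in S, g =1 h}.
Proof.
split=> [/addrI/oppr_inj/ffunP gh v vS|gh].
  by have := gh v; rewrite !ffunE vS => /eqP; rewrite eqr_int => /eqP.
congr (_ - _); apply/ffunP => v; rewrite !ffunE.
by case: ifP => // /gh ->.
Qed.

Lemma pairE_Evec S v : v \in S -> pairE S (Evec S) v = (e v + val S v)%:~R.
Proof.
move=> vS; rewrite /Defs.pairE.
under eq_bigr => w wS do rewrite ffunE wS mul1r Mform_int.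
rewrite -rmorph_sum /=; congr (_%:~R).
rewrite (bigD1 v) //= {1}/Mint eqxx; congr (_ + _).
have -> : \sum_(i in S | i != v) Mint i v = \sum_(i in S) (adj v i)%:R.
  rewrite [RHS](bigD1 v) //= adjI add0r.
  by apply: eq_bigr => w /andP[_ /negbTE wv]; rewrite /Mint wv adjC.
rewrite /valency -sum1_card -natz natr_sum [RHS]big_mkcond /=.
rewrite [LHS]big_mkcond; apply: eq_bigr => w _.
by rewrite inE; case: (w \in S); case: (adj v w).
Qed.

Lemma pairE_dualvec S g v : neg_def adj e S -> v \in S ->
  pairE S (dualvec S g) v = (- expo S g v)%:~R.
Proof.
move=> /(ZKP adjC)[_ zk] vS; rewrite !pairEB zk // pairE_Evec //.
have -> : pairE S (intvec S g) v = (\sum_(w in S) g w * Mint w v)%:~R.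
  rewrite rmorph_sum; apply: eq_bigr => w wS.
  by rewrite ffunE wS Mform_int -intrM.
by rewrite -!rmorphB /=; congr (_%:~R); rewrite /expo; ring.
Qed.

Lemma zcoef_dualvec S g : neg_def adj e S ->
  zcoef S (dualvec S g) = weight S g.
Proof.
move=> nd; rewrite /Defs.zcoef /weight.
case: ifP => [/forall_inP ge0|/forall_inPn[v vS]].
  apply: eq_bigr => v vS; have := ge0 v vS.
  rewrite pairE_dualvec // numq_int oppr_le0 => /andP[_ n0].
  by rewrite /coefz n0 abszN.
rewrite pairE_dualvec // numq_int denq_int eqxx /= oppr_le0 => n0.
by rewrite (bigD1 v) //= /coefz (negbTE n0) mul0r.
Qed.

Lemma Supp_dualvec S g : neg_def adj e S ->
  Supp S (dualvec S g) <-> (exists2 v, v \in S & 0 <= g v) /\ weight S g != 0.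
Proof.
move=> nd; rewrite /Defs.Supp zcoef_dualvec //; split=> [[_ [l [_ ng]]]|].
  move=> /addrI/oppr_inj lE w0; split=> //.
  case: (boolP [exists v in S, 0 <= g v]) => [/exists_inP //|/exists_inPn g0].
  case: ng => v vS; rewrite -lE ffunE vS ltrz0; have := g0 v vS; lia.
move=> [[v vS gv] w0]; split=> //.
  by move=> w wS; rewrite !ffunE (negbTE wS) (ZKP adjC nd).1 // !subr0.
exists (intvec S g); split=> //.
  split=> w; first by move=> wS; rewrite ffunE (negbTE wS).
  by rewrite ffunE; case: ifP => _; rewrite ?rpred0 ?intr_int.
by move=> /(_ v vS); rewrite ffunE vS ltrz0 ltNge gv.
Qed.

Lemma Supp_dualvecE S x : Supp S x -> exists g, x = dualvec S g.
Proof.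
case=> _ [l [[sl il] _ ->]] _; exists (fun v => Num.floor (l v)).
congr (_ - _); apply/ffunP => v; rewrite ffunE.
by case: ifP => [_|/negbT/sl //]; rewrite floorK.
Qed.

Lemma piproj_dualvec S S' g : S \subset S' ->
  piproj S S' (dualvec S' g) = dualvec S g.
Proof.
move=> sub; congr (_ - _); apply/ffunP => v; rewrite !ffunE.
by case: ifP => // /(subsetP sub) ->; rewrite subKr.
Qed.

(** A nonnegative coordinate of [g] on [S] survives in every extension [h], so membership in the
    larger support comes down to a nonzero weight. *)
Lemma piinv_dualvec S S' g : neg_def adj e S -> neg_def adj e S' ->
  S \subset S' -> Supp S (dualvec S g) -> forall x,
  piinv S S' (dualvec S g) x <->
  exists h, [/\ x = dualvec S' h, {in S, h =1 g} & weight S' h != 0].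
Proof.
move=> nd nd' sub /(Supp_dualvec _ nd)[[v vS gv] _] x; split.
  move=> [sx]; have [h xE] := Supp_dualvecE sx; move: sx; rewrite xE.
  move=> /(Supp_dualvec _ nd')[_ w0]; rewrite piproj_dualvec // => /dualvecP hg.
  by exists h.
move=> [h [-> hg w0]]; split; last by rewrite piproj_dualvec //; apply/dualvecP.
apply/(Supp_dualvec _ nd'); split=> //; exists v; first exact: (subsetP sub).
by rewrite hg.
Qed.

Lemma coefz_Posz_neq0 (m : nat) (n : int) : (coefz m n != 0) = (0 <= n <= m%:Z).
Proof.
rewrite /coefz; case: (boolP (0 <= n)) => [n0|]; last by rewrite eqxx.
by rewrite /coefk mulf_eq0 signr_eq0 /= -lt0n bin_gt0; lia.
Qed.

Lemma coefz_leaf (n : int) : coefz (-1) n = (0 <= n)%R%:R.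
Proof. by rewrite /coefz /= add0n binn; case: ifP. Qed.

(** * Attaching leaves to an end-vertex *)

Section Attach.
Variables (S S' : {set T}) (u : T).
Hypotheses (sub : S \subset S') (uS : u \in S) (val_u : valency adj S u = 1%N).
Hypothesis nbD : forall w, w \in S' :\: S -> [set x in S' | adj w x] = [set u].
Local Notation D := (S' :\: S).

Lemma adj_new w v : w \in D -> v \in S' -> adj w v = (v == u).
Proof. by move=> wD vS; have /setP/(_ v) := nbD wD; rewrite !inE vS. Qed.

Lemma expo_new g w : w \in D -> expo S' g w = e w * g w + g u - 1.
Proof.
move=> wD; have wS' : w \in S' by case/setDP: wD.
have uw : u != w by apply: contraTneq wD => <-; rewrite inE uS.
have uS' : u \in S' := subsetP sub u uS.
rewrite /expo /valency nbD // cards1 (bigD1 w) //= (bigD1 u) ?uS' //= big1.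
  by rewrite {1 2}/Mint eqxx (negbTE uw) adjC adj_new // eqxx mulr1 addr0 -[_%:Z]/(1 : int); ring.
move=> v /andP[/andP[vS' vw] vu]; rewrite /Mint (negbTE vw) adjC adj_new //.
by rewrite (negbTE vu) mulr0.
Qed.

Lemma big_attach (F : T -> int) :
  \sum_(v in S') F v = \sum_(v in S) F v + \sum_(v in D) F v.
Proof. by rewrite (big_setID S) /= (setIidPr sub). Qed.

Lemma valency_attach v : v \in S ->
  valency adj S' v = (valency adj S v + (v == u) * #|D|)%N.
Proof.
move=> vS; rewrite /valency -(cardsID S).
have -> : [set w in S' | adj v w] :&: S = [set w in S | adj v w].
  apply/setP => w; rewrite !inE andbC; case wS: (w \in S) => //=.
  by rewrite (subsetP sub _ wS).
congr (_ + _)%N; have vS' := subsetP sub v vS.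
case: eqP => vu; rewrite ?mul0n ?mul1n.
  apply: eq_card => w; rewrite !inE; case wS: (w \in S) => //=.
  by case wS': (w \in S') => //=; rewrite adjC adj_new ?inE ?wS //; apply/eqP.
apply/eqP; rewrite cards_eq0 -subset0; apply/subsetP => w.
rewrite !inE => /and3P[wS wS']; rewrite adjC adj_new ?inE ?wS //.
by move/eqP.
Qed.

(** Each new leaf [w] contributes [g w] through its edge to [u] and 1 through the valency of [u]. *)
Lemma expo_attach g v : v \in S ->
  expo S' g v = expo S g v + (v == u)%:R * \sum_(w in D) (g w + 1).
Proof.
move=> vS; have vS' := subsetP sub v vS.
rewrite /expo big_attach valency_attach //.
have -> : \sum_(w in D) g w * Mint w v = (v == u)%:R * \sum_(w in D) g w.
  rewrite mulr_sumr; apply: eq_bigr => w wD; rewrite /Mint adj_new //.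
  have -> : (w == v) = false by apply: contraTF wD => /eqP ->; rewrite inE vS.
  by rewrite mulrC.
rewrite big_split /= sumr_const PoszD PoszM -natz.
by case: (v == u); rewrite -?[#|_|%:Z]natz; ring.
Qed.

Lemma val_new w : w \in D -> valency adj S' w = 1%N.
Proof. by move=> wD; rewrite /valency nbD // cards1. Qed.

(** The factors that leaves at [u] do not change; they depend only on the old coordinates and come
    out of sums over the new ones. *)
Definition old_weight g :=
  \prod_(v in S :\ u) coefz (val S v - 2) (expo S g v).

Lemma eq_old_weight g h : {in S, g =1 h} -> old_weight g = old_weight h.
Proof. by move=> gh; apply: eq_bigr => v _; rewrite (eq_expo _ gh). Qed.

(** The valency of [u] rises from 1 to 1 + |D|, so its factor becomes (1-x)^(|D|-1); a leaf has the
    factor 1/(1-x), all of whose coefficients are 1. *)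
Lemma weight_attach g : weight S' g =
  old_weight g *
  (coefz (#|D|%:Z - 1) (expo S g u + \sum_(w in D) (g w + 1)) *
  \prod_(w in D) (0 <= e w * g w + g u - 1)%R%:R).
Proof.
rewrite /weight (big_setID S) /= (setIidPr sub) (big_setD1 u) //=.
rewrite [old_weight _ * _]mulrCA mulrA; congr (_ * _ * _).
- by rewrite valency_attach // expo_attach // eqxx mul1r mul1n val_u; congr coefz; lia.
- apply: eq_bigr => v /setD1P[/negbTE vu vS].
  by rewrite valency_attach // expo_attach // vu mul0r addr0 mul0n addn0.
- by apply: eq_bigr => w wD; rewrite val_new // expo_new // coefz_leaf.
Qed.

Lemma weight_end g : weight S g = old_weight g * (0 <= expo S g u)%R%:R.
Proof.
by rewrite /weight (big_setD1 u) //= val_u coefz_leaf mulrC.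
Qed.

Hypothesis neD : (0 < #|D|)%N.

Lemma weight_attach_neq0 g : weight S' g != 0 <->
  [/\ old_weight g != 0,
      0 <= expo S g u + \sum_(w in D) (g w + 1) < #|D|%:Z &
      forall w, w \in D -> 0 <= e w * g w + g u - 1].
Proof.
rewrite weight_attach !mulf_eq0 !negb_or.
have -> : #|D|%:Z - 1 = (#|D|.-1)%:Z by lia.
rewrite coefz_Posz_neq0; split=> [/and3P[-> n0 /prodf_neq0 leaf]|[-> n0 leaf]].
  split=> //; first lia.
  by move=> w /leaf; case: (0 <= _).
apply/and3P; split=> //; first lia.
by apply/prodf_neq0 => w /leaf ->.
Qed.

Hypothesis e_neg : forall w, w \in D -> e w <= -2.

(** The exponent at [u] grows with the leaf coordinates, which are bounded by the quotients; if it
    is nonnegative at these maxima, lowering one leaf brings it to 0. *)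
Lemma extensionP g :
  (exists h, {in S, h =1 g} /\ weight S' h != 0) <->
  old_weight g != 0 /\
  0 <= expo S g u + \sum_(w in D) (((g u - 1) %/ - e w)%Z + 1).
Proof.
split=> [[h [hg /weight_attach_neq0[w0 /andP[n0 _] leaf]]]|[w0 n0]].
  rewrite -(eq_old_weight hg) w0 -(eq_expo _ hg); split=> //.
  apply: le_trans n0 _; rewrite lerD2l; apply: ler_sum => w wD.
  by rewrite lerD2r -leaf_ge0 ?e_neg // -(hg u uS) leaf.
have [w1 w1D] : exists w, w \in D by apply/set0Pn; rewrite -card_gt0.
set n := expo S g u + _ in n0.
(* The whole surplus [n] is taken off at [w1], so the exponent at [u] is exactly 0. *)
pose h v := if v \in D then ((g u - 1) %/ - e v)%Z - (v == w1)%:R * n else g v.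
have hg : {in S, h =1 g} by move=> v vS; rewrite /h inE vS.
exists h; split=> //; apply/weight_attach_neq0; split.
- by rewrite (eq_old_weight hg).
- suff -> : expo S h u + \sum_(w in D) (h w + 1) = 0 by rewrite lexx; lia.
  rewrite (eq_expo _ hg) (bigD1 w1) //= {1}/h w1D eqxx mul1r.
  have -> : \sum_(w in D | w != w1) (h w + 1) =
      \sum_(w in D | w != w1) (((g u - 1) %/ - e w)%Z + 1).
    by apply: eq_bigr => w /andP[wD /negbTE ww]; rewrite /h wD ww mul0r subr0.
  by rewrite /n (bigD1 w1) //=; ring.
- move=> w wD; rewrite leaf_ge0 ?e_neg // (hg u uS) /h wD.
  by case: eqP => _; lia.
Qed.

End Attach.
End Encoding.

(** * Alternating sums over boxes *)

Section SignedBox.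
Implicit Types d K : nat.

Lemma coef_exp1subX d n : ((1 - 'X) ^+ d : {poly int})`_n = coefk d n.
Proof.
rewrite exprBn.
rewrite (eq_bigr (fun i : 'I_d.+1 => ((-1) ^+ i * 'C(d, i)%:Z) *: 'X^i)); last first.
  move=> i _; rewrite expr1n mulr1 -mulr_natr -[in RHS]mul_polyC.
  by rewrite rmorphM rmorphXn rmorphN1 /= -[('C(d, i))%:Z]natz rmorph_nat; ring.
rewrite -(poly_def d.+1 (fun i => (-1) ^+ i * 'C(d, i)%:Z)) coef_poly; case: ltnP => // dn.
by rewrite /coefk bin_small ?mulr0.
Qed.

(** The shift by X^n lets the degree [K] stay fixed while [n] varies; for n > K both sides
    vanish. *)
Lemma coefz_1subX d K n : coefz d (K%:Z - n%:Z) = ((1 - 'X) ^+ d * 'X^n : {poly int})`_K.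
Proof.
rewrite coefMXn coef_exp1subX /coefz; case: ltnP => nK.
  by case: ifP => //; lia.
by rewrite subr_ge0 lez_nat nK subzn.
Qed.

(** The first factor is 1 modulo X^(K+1). *)
Lemma coef_exp1subXn_mul d K (q : {poly int}) :
  ((1 - 'X^(K.+1)) ^+ d * q)`_K = q`_K.
Proof.
elim: d => [|d IH]; first by rewrite mul1r.
by rewrite exprS -mulrA mulrBl mul1r coefB coefXnM ltnSn subr0.
Qed.

(* Each of the m - 1 free summation variables contributes a factor
   1 / (1 - X), which cancels against (1 - X)^(m - 1). *)
Lemma sum_signed_box (T : finType) (D : {set T}) (w0 : T) K (Q : pred 'I_K.+1) :
  w0 \in D ->
  \sum_(f in pfamily ord0 (mem D) (fun w => if w == w0 then Q else predT))
    coefz (#|D|%:Z - 1) (K%:Z - \sum_(w in D) (f w)%:Z) = (Q ord_max)%:R.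
Proof.
move=> w0D; pose Qs w : pred 'I_K.+1 := if w == w0 then Q else predT; rewrite -/Qs.
have D_gt0 : (0 < #|D|)%N by apply/card_gt0P; exists w0.
pose d := #|D|.-1.
transitivity (\sum_(f in pfamily ord0 (mem D) Qs)
    ((1 - 'X) ^+ d * \prod_(w in D) 'X^(f w) : {poly int})`_K).
  apply: eq_bigr => f _; rewrite -(big_morph _ PoszD (erefl 0%:Z)).
  have -> : #|D|%:Z - 1 = d by rewrite /d; lia.
  by rewrite coefz_1subX prodrXr.
(* By distributivity the sum over the box is a product over D: the factor at [w0] is the sum of the
   X^j with [Q j], every other one is 1 + ... + X^K. *)
rewrite -coef_sum -mulr_sumr -(big_distr_big_dep _ _ _ (fun _ (j : 'I_K.+1) => 'X^j)).
rewrite (bigD1 w0) //= /Qs eqxx mulrC -mulrA mulrC -mulrA.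
have -> : \prod_(w in D | w != w0)
    \sum_(j | (if w == w0 then Q else predT) j) 'X^j =
    (\sum_(j < K.+1) 'X^j : {poly int}) ^+ d.
  rewrite (eq_bigr (fun _ => \sum_(j < K.+1) 'X^j)); last first.
    by move=> w /andP[_ /negbTE ->].
  rewrite prodr_const; congr (_ ^+ _); rewrite /d (cardD1 w0 D) w0D /=.
  by apply: eq_card => w; rewrite !inE andbC.
rewrite mulrA -exprMn.
have -> : (\sum_(j < K.+1) 'X^j) * (1 - 'X) = 1 - 'X^(K.+1) :> {poly int}.
  by rewrite -[1 - 'X^_]opprB subrX1 mulrC -mulNr opprB.
(* Only the factor at [w0] is left, and only j = K contributes to its coefficient of X^K. *)
rewrite coef_exp1subXn_mul coef_sum big_mkcond (bigD1 ord_max) //=.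
rewrite coefXn eqxx big1 ?addr0; first by case: (Q _).
move=> j jK; case: ifP => // _; rewrite coefXn.
by rewrite eq_sym -[K]/(nat_of_ord (@ord_max K)) (inj_eq val_inj) (negbTE jK).
Qed.

End SignedBox.

(** * Consequences of ellipticity *)

(** Since b >= 1, raising y by t raises ceil(y / b), which is the quotient plus 1, by at most t. *)
Lemma divz_growth (b y y' : int) : 0 < b -> y <= y' ->
  ((y' - 1) %/ b)%Z <= ((y - 1) %/ b)%Z + (y' - y).
Proof.
move=> b0 yy; rewrite -ltzD1 ltz_divLR //.
have : (y - 1 < (((y - 1) %/ b)%Z + 1) * b) by rewrite -ltz_divLR // ltzD1.
nia.
Qed.

Section EndVertex.
Variables (T : finType) (adj : rel T) (e : T -> int).
Hypotheses (adjC : symmetric adj) (adjI : irreflexive adj).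
Variables (S0 S1 S2 : {set T}) (u w0 : T).
Hypotheses (sub01 : S0 \subset S1) (uS : u \in S0).
Hypothesis nb1 : forall w, w \in S1 :\: S0 -> [set x in S1 | adj w x] = [set u].
Hypotheses (sub12 : S1 \subset S2) (w0D : w0 \in S1 :\: S0).
Hypothesis nb2 : forall w, w \in S2 :\: S1 -> [set x in S2 | adj w x] = [set w0].
Hypotheses (ell0 : elliptic adj e S0) (ell2 : elliptic adj e S2).
Local Notation D2 := (S2 :\: S1).

(* Ellipticity of the largest graph, tested on l + 2 E_{w0} + sum_{D2} E_w
   where l lives on S0, has chi(l) <= 0 and multiplicity at least 1 at u. *)
Lemma card_new_le : #|D2|%:Z <= - e w0.
Proof.
have [[_ conn0 _] nd0 _ [l [il pl cl]] _] := ell0.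
have [_ nd2 _ _ chi2] := ell2.
have sub02 := subset_trans sub01 sub12.
have [w0S1 w0S0] := setDP w0D; have w0S2 := subsetP sub12 _ w0S1.
have uS2 := subsetP sub02 _ uS.
have cl0 : chi adj e S0 l <= 0 by rewrite cl.
have [a [[sa ia] pa ca au]] := chi_le0_at adjC adjI nd0 conn0 il pl cl0 uS.
(* Multiplicity 2 at [w0] gives (b, E_v) = e_v + 2 = (Z_K, E_v) at each new leaf v, so the leaves
   enter chi(b) only through the term at [w0]. *)
pose b : vec T := [ffun v => if v == w0 then 2 else (v \in D2)%:R].
have sum_b (F : T -> rat) :
    \sum_(v in S2) b v * F v = 2 * F w0 + \sum_(v in D2) F v.
  rewrite (bigD1 w0) //= ffunE eqxx; congr (_ + _).
  rewrite (eq_bigr (fun v => if v \in D2 then F v else 0)); last first.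
    move=> v /andP[_ /negbTE vw]; rewrite ffunE vw.
    by case: (v \in D2); rewrite ?mul1r ?mul0r.
  rewrite -big_mkcondr; apply: eq_bigl => v; rewrite inE.
  case: (eqVneq v w0) => [->|_]; first by rewrite w0S1 /= !andbF.
  by rewrite andbT; case: (v \in S2); rewrite ?andbF.
have w0u : (w0 == u) = false by apply: contraNF w0S0 => /eqP ->.
have a_w0 : pairE adj e S2 a w0 = a u.
  rewrite (pairE_supported adj e _ sub02 sa) /pairE (bigD1 u) //= big1.
    rewrite MformC // /Mform w0u (adj_new nb1 w0D) ?(subsetP sub01) //.
    by rewrite eqxx mulr1 addr0.
  move=> v /andP[vS /negbTE vu]; rewrite MformC // /Mform.
  rewrite (adj_new nb1 w0D) ?(subsetP sub01) // vu.
  case: eqP => [w0v|_]; last by rewrite mulr0.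
  by rewrite w0v vS in w0S0.
have a_D2 v : v \in D2 -> pairE adj e S2 a v = 0.
  move=> vD; have [vS2 vS1] := setDP vD.
  rewrite (pairE_supported adj e _ sub02 sa) /pairE big1 // => w wS.
  rewrite MformC // /Mform (adj_new nb2 vD) ?(subsetP sub02) //.
  case: eqP => [vw|_]; first by rewrite vw (subsetP sub01) in vS1.
  case: eqP => [ww|_]; last by rewrite mulr0.
  by rewrite -ww wS in w0S0.
have b_w0 : pairE adj e S2 b w0 = 2 * (e w0)%:~R + #|D2|%:R.
  rewrite /pairE sum_b /Mform eqxx; congr (_ + _).
  rewrite (eq_bigr (fun _ => 1)) ?sumr_const // => v vD.
  have [vS2 vS1] := setDP vD; rewrite (adj_new nb2 vD) // eqxx.
  by case: eqP => // vw; rewrite vw w0S1 in vS1.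
have b_D2 v : v \in D2 -> pairE adj e S2 b v = 2 + (e v)%:~R.
  move=> vD; have [vS2 vS1] := setDP vD.
  have vw : (w0 == v) = false by apply: contraNF vS1 => /eqP <-.
  rewrite /pairE sum_b {1}/Mform vw adjC (adj_new nb2 vD) // eqxx mulr1.
  congr (_ + _); rewrite (bigD1 v) //= /Mform eqxx big1 ?addr0 //.
  move=> w /andP[wD /negbTE wv]; rewrite wv (adj_new nb2 wD) //.
  by rewrite eq_sym vw.
have chi_b : chi adj e S2 b = 2 - (e w0)%:~R - #|D2|%:R.
  rewrite (chiE adjC) // sum_b b_w0 big1 ?addr0; last first.
    by move=> v /b_D2 ->; rewrite intrD; ring.
  by rewrite intrD; field.
(* [a] and [b] meet only along the edge from [u] to [w0]; the cross term 2 a_u >= 2 cancels the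
   constant 2 of chi(b). *)
have chi_ab : chi adj e S2 (a + b) <= - (e w0)%:~R - #|D2|%:R.
  rewrite (chiD adjC) // (chi_supported adjC nd0 nd2 sub02 sa) chi_b sum_b.
  rewrite a_w0 big1 ?addr0; last exact: a_D2.
  by lra.
have chi_ge0 : 0 <= chi adj e S2 (a + b).
  apply: chi2; split.
  - move=> v vS2; rewrite !ffunE sa; last by apply: contraNN vS2; apply: subsetP.
    rewrite add0r ifF; last by apply: contraNF vS2 => /eqP ->.
    by rewrite inE (negbTE vS2) andbF.
  - by move=> v; rewrite !ffunE rpredD ?ia //; case: ifP => _; rewrite natr_int.
  - move=> v vS2; rewrite !ffunE addr_ge0 //; last by case: ifP => _; rewrite ler0n.
    by case: (boolP (v \in S0)) => [/pa //|/sa ->].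
  - apply/eqP => /ffunP/(_ u); rewrite !ffunE.
    have -> : (u == w0) = false by rewrite eq_sym.
    apply/eqP; rewrite gt_eqF // ltr_wpDr ?ler0n //.
    exact: lt_le_trans ltr01 au.
have := le_trans chi_ge0 chi_ab.
by rewrite -mulrNz -[#|D2|%:R]/(#|D2|%:Z%:~R) -rmorphB /= ler0z subr_ge0.
Qed.

(** The function F: the exponent at [w0] when its multiplicity is [y] and all leaves attached to it
    are maximal. *)
Definition end_excess (g : T -> int) (y : int) : int :=
  e w0 * y + g u - 1 + \sum_(w in D2) (((y - 1) %/ - e w)%Z + 1).

(** Raising y by t adds e_{w0} t and at most t for each leaf in [D2], and [card_new_le] bounds the
    number of these leaves by -e_{w0}. *)
Lemma end_excess_antitone (g : T -> int) (y y' : int) :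
  y <= y' -> end_excess g y' <= end_excess g y.
Proof.
move=> yy; have [_ _ e2 _ _] := ell2.
have : \sum_(w in D2) (((y' - 1) %/ - e w)%Z + 1) <=
    \sum_(w in D2) (((y - 1) %/ - e w)%Z + 1 + (y' - y)).
  apply: ler_sum => w /setDP[/e2 ew _].
  by rewrite addrAC lerD2r divz_growth //; lia.
rewrite [X in _ <= X]big_split /= sumr_const -mulr_natl natz => le_sum.
have le_card : 0 <= (y' - y) * (- e w0 - #|D2|%:Z).
  by rewrite mulr_ge0 ?subr_ge0 ?card_new_le.
move: le_sum le_card; rewrite /end_excess; set s := \sum_(_ in _) _; set s' := \sum_(_ in _) _.
set m := #|_|%:Z; move: s s' m; lia.
Qed.

End EndVertex.

(** * Fibers of the projections *)

Section Fibers.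
Variables (T : finType) (adj : rel T) (e : T -> int).
Hypotheses (adjC : symmetric adj) (adjI : irreflexive adj).
Variables (S0 S1 S2 : {set T}) (u u1 : T) (g : T -> int).
Hypotheses (ell0 : elliptic adj e S0) (ell1 : elliptic adj e S1).
Hypothesis ell2 : elliptic adj e S2.
Hypotheses (pr01 : S0 \proper S1) (uS : u \in S0) (val_u : valency adj S0 u = 1%N).
Hypothesis nb1 : forall w, w \in S1 :\: S0 -> [set x in S1 | adj w x] = [set u].
Hypotheses (pr12 : S1 \proper S2) (u1S : u1 \in S1) (val_u1 : valency adj S1 u1 = 1%N).
Hypothesis nb2 : forall w, w \in S2 :\: S1 -> [set x in S2 | adj w x] = [set u1].
Hypothesis supp_g : Supp adj e S0 (dualvec adj e S0 g).
Hypothesis ne_fiber : exists x, piinv adj e S0 S2 (dualvec adj e S0 g) x.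
Local Notation dualvec := (dualvec adj e).
Local Notation piinv := (Defs.piinv adj e).
Local Notation weight := (weight adj e).
Local Notation expo := (expo adj e).
Local Notation D1 := (S1 :\: S0).
Local Notation D2 := (S2 :\: S1).

Let nd0 : neg_def adj e S0. Proof. by case: ell0. Qed.
Let nd1 : neg_def adj e S1. Proof. by case: ell1. Qed.
Let nd2 : neg_def adj e S2. Proof. by case: ell2. Qed.
Let sub01 : S0 \subset S1. Proof. exact: proper_sub. Qed.
Let sub12 : S1 \subset S2. Proof. exact: proper_sub. Qed.
Let D1_gt0 : (0 < #|D1|)%N.
Proof. by have [_ [w w1 w0]] := properP pr01; apply/card_gt0P; exists w; rewrite inE w0. Qed.
Let D2_gt0 : (0 < #|D2|)%N.
Proof. by have [_ [w w1 w0]] := properP pr12; apply/card_gt0P; exists w; rewrite inE w0. Qed.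
Let e1 w : w \in D1 -> e w <= -2.
Proof. by case: ell1 => _ _ e_le _ _ /setDP[/e_le]. Qed.
Let e2 w : w \in D2 -> e w <= -2.
Proof. by case: ell2 => _ _ e_le _ _ /setDP[/e_le]. Qed.

Let fiber01P x : piinv S0 S1 (dualvec S0 g) x <->
  exists h, [/\ x = dualvec S1 h, {in S0, h =1 g} & weight S1 h != 0].
Proof. exact: piinv_dualvec. Qed.

Lemma fiber12P h : {in S0, h =1 g} -> weight S1 h != 0 ->
  (exists x, piinv S1 S2 (dualvec S1 h) x) <->
  0 <= expo S1 h u1 + \sum_(w in D2) (((h u1 - 1) %/ - e w)%Z + 1).
Proof.
move=> hg w1.
have supp_h : Supp adj e S1 (dualvec S1 h).
  by have [] := (fiber01P (dualvec S1 h)).2 (ex_intro _ h (And3 erefl hg w1)).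
have ow : old_weight adj e S1 u1 h != 0.
  by move: w1; rewrite (weight_end e u1S val_u1) mulf_eq0 negb_or => /andP[].
have ext := extensionP adjC sub12 u1S val_u1 nb2 D2_gt0 e2 h.
split=> [[y /(piinv_dualvec adjC adjI nd1 nd2 sub12 supp_h)[h2 [_ h2h w2]]]|].
  by have [] := ext.1 (ex_intro _ h2 (conj h2h w2)).
move=> n0; have [h2 [h2h w2]] := ext.2 (conj ow n0).
exists (dualvec S2 h2).
by apply/(piinv_dualvec adjC adjI nd1 nd2 sub12 supp_h); exists h2.
Qed.

(** A point over [S2] gives [h]. Its weight over [S1] may vanish, because the exponent at [u1] there
    can be negative; hence only [old_weight] is asserted to be nonzero. *)
Let fiber02 : exists h, [/\ {in S0, h =1 g}, old_weight adj e S1 u1 h != 0 &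
  0 <= expo S1 h u1 + \sum_(w in D2) (((h u1 - 1) %/ - e w)%Z + 1)].
Proof.
have [x] := ne_fiber; have sub02 := subset_trans sub01 sub12.
move=> /(piinv_dualvec adjC adjI nd0 nd2 sub02 supp_g)[h [_ hg w2]].
have ext := extensionP adjC sub12 u1S val_u1 nb2 D2_gt0 e2 h.
by have [] := ext.1 (ex_intro _ h (conj (fun _ _ => erefl) w2)); exists h.
Qed.

(** [u] has valency at least 2 in [S1], so [u1] differs from it, and the exponent at [u1] is
    determined by [g]: one extendable point makes all extendable. *)
Lemma fiber12_neq0_old h : u1 \in S0 -> {in S0, h =1 g} -> weight S1 h != 0 ->
  exists x, piinv S1 S2 (dualvec S1 h) x.
Proof.
move=> u1S0 hg w1; apply/(fiber12P hg w1); have [h2 [h2g _]] := fiber02.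
have u1u : (u1 == u) = false.
  apply/eqP => u1u; move: val_u1.
  by rewrite u1u (valency_attach adjC sub01 nb1 uS) eqxx val_u; lia.
rewrite !(expo_attach e adjC sub01 nb1 _ u1S0) u1u !mul0r.
by rewrite h2g // hg // (eq_expo _ _ _ h2g) (eq_expo _ _ _ hg).
Qed.

(** * The second end-vertex is one of the new leaves *)

Section NewEnd.
Hypothesis u1D : u1 \in D1.
Local Notation c w := ((g u - 1) %/ - e w)%Z.
Local Notation excess := (end_excess e S1 S2 u u1 g).
(** [K] is the exponent at [u] when every new leaf [w] has its maximal multiplicity [c w]. *)
Variable K : nat.
Hypothesis KE : expo S0 g u + \sum_(w in D1) (c w + 1) = K.

Lemma fiber12_excess h : {in S0, h =1 g} -> weight S1 h != 0 ->
  (exists x, piinv S1 S2 (dualvec S1 h) x) <-> 0 <= excess (h u1).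
Proof.
move=> hg w1; apply: (iff_trans (fiber12P hg w1)).
by rewrite (expo_new e adjC sub01 uS nb1) // (hg u uS).
Qed.

(** For the point [h] of [fiber02], a nonnegative exponent at [u] and the bounds at the other leaves
    force h(u1) >= c(u1) - K; then F is at least as large at c(u1) - K as at h(u1), where it is
    nonnegative. *)
Lemma excess_extremal : 0 <= excess (c u1 - K%:Z).
Proof.
have [h [hg ow n0]] := fiber02.
have le_u1 : c u1 - K%:Z <= h u1.
  have wt v : v \in S1 -> v != u1 ->
      coefz ((valency adj S1 v)%:Z - 2) (expo S1 h v) != 0.
    by move=> vS vu; have /prodf_neq0/(_ v) := ow; apply; rewrite !inE vu.
  have ge0 v : v \in S1 -> v != u1 -> 0 <= expo S1 h v.
    by move=> vS vu; have := wt v vS vu; rewrite /coefz; case: ifP; rewrite ?eqxx.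
  have u1u : u != u1 by apply: contraTneq u1D => <-; rewrite inE uS.
  have := ge0 u (subsetP sub01 _ uS) u1u.
  rewrite (expo_attach e adjC sub01 nb1 _ uS) eqxx mul1r (eq_expo _ _ _ hg).
  rewrite -KE (bigD1 u1) //= [X in c u1 - (_ + X)](bigD1 u1) //=.
  have : \sum_(w in D1 | w != u1) (h w + 1) <= \sum_(w in D1 | w != u1) (c w + 1).
    apply: ler_sum => w /andP[wD wu]; have [wS _] := setDP wD.
    have := ge0 w wS wu; rewrite (expo_new e adjC sub01 uS nb1) // (hg u uS).
    by rewrite leaf_ge0 ?e1 // lerD2r.
  by set s := \sum_(_ in _ | _) _; set s' := \sum_(_ in _ | _) _; move: s s' => s s'; lia.
apply: le_trans (end_excess_antitone adjC adjI sub01 uS nb1 sub12 u1D nb2 ell0 ell2 g le_u1).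
by move: n0; rewrite (expo_new e adjC sub01 uS nb1) // (hg u uS).
Qed.

(** [f w] is the drop below the maximum [c w]: the leaf conditions then hold, and the exponent at
    [u] is K minus the sum of the drops. *)
Definition box_vec (f : {ffun T -> 'I_K.+1}) w : int :=
  if w \in D1 then c w - (f w)%:Z else g w.

Lemma box_vec_old f : {in S0, box_vec f =1 g}.
Proof. by move=> v vS; rewrite /box_vec inE vS. Qed.

(** Drops are nonnegative by the leaf conditions, and their sum is at most [K] since the exponent at
    [u] is nonnegative, so each fits into ['I_K.+1]. *)
Lemma box_vec_surj h : {in S0, h =1 g} -> weight S1 h != 0 ->
  exists f, {in S1, box_vec f =1 h} /\ forall w, w \notin D1 -> f w = ord0.
Proof.
move=> hg /(weight_attach_neq0 e adjC sub01 uS val_u nb1 D1_gt0)[_ /andP[n0 _] leaf].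
have le_c w : w \in D1 -> h w <= c w.
  by move=> wD; rewrite -leaf_ge0 ?e1 // -(hg u uS) leaf.
have le_K w : w \in D1 -> c w - h w <= K.
  move=> wD; rewrite -KE -(eq_expo _ _ _ hg).
  have : \sum_(v in D1 | v != w) (h v + 1) <= \sum_(v in D1 | v != w) (c v + 1).
    by apply: ler_sum => v /andP[vD _]; rewrite lerD2r le_c.
  move: n0; rewrite !(bigD1 w wD) /=.
  by set s := \sum_(_ in _ | _) _; set s' := \sum_(_ in _ | _) _; move: s s' => s s'; lia.
exists [ffun w => if w \in D1 then inord `|c w - h w|%N else ord0].
split=> [w wS|w /negbTE wD]; last by rewrite ffunE wD.
rewrite /box_vec ffunE; case: (boolP (w \in D1)) => [wD|].
  by rewrite inordK; have := le_K w wD; have := le_c w wD; lia.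
by rewrite inE wS andbT negbK => /hg ->.
Qed.

(** Points of weight zero are kept, so that this is a genuine product with a condition at [u1]
    alone; the value [ord0] off [D1] makes [f] unique. *)
Definition nonext_box :=
  pfamily ord0 (mem D1) (fun w => if w == u1
    then (fun j : 'I_K.+1 => excess (c u1 - j%:Z) < 0) else predT).

Lemma nonext_boxP f : f \in nonext_box <->
  (forall w, w \notin D1 -> f w = ord0) /\ excess (box_vec f u1) < 0.
Proof.
rewrite /box_vec u1D; split=> [/pfamilyP[/supportP f0 fQ]|[f0 neg]].
  by split=> //; have := fQ u1 u1D; rewrite eqxx.
apply/pfamilyP; split; first exact/supportP.
by move=> w wD; case: eqP => // ->.
Qed.

(** After the constant [old_weight] is pulled out, [sum_signed_box] leaves only the indicator of
    drop K at [u1], which is 0 by [excess_extremal]. *)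
Lemma sum_nonext_box : \sum_(f in nonext_box) weight S1 (box_vec f) = 0.
Proof.
transitivity (\sum_(f in nonext_box) old_weight adj e S0 u g *
    coefz (#|D1|%:Z - 1) (K%:Z - \sum_(w in D1) (f w)%:Z)).
  apply: eq_bigr => f _; rewrite (weight_attach e adjC sub01 uS val_u nb1).
  rewrite (eq_old_weight _ _ _ (box_vec_old f)) (eq_expo _ _ _ (box_vec_old f)).
  congr (_ * _); rewrite [\prod_(w in D1) _]big1 ?mulr1.
    congr coefz; rewrite -KE -[RHS]addrA; congr (_ + _).
    rewrite -sumrB; apply: eq_bigr => w wD.
    by rewrite /box_vec wD addrAC.
  move=> w wD; rewrite (box_vec_old f uS) leaf_ge0 ?e1 // /box_vec wD.
  by rewrite gerBl.
rewrite -mulr_sumr /nonext_box (sum_signed_box _ u1D) /=.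
by rewrite ltNge excess_extremal mulr0.
Qed.

End NewEnd.

Lemma nonext_sum : exists s : seq (vec T),
  [/\ uniq s,
      (forall x, x \in s <->
        (piinv S0 S1 (dualvec S0 g) x /\ ~ (exists y, piinv S1 S2 x y))) &
      \sum_(x <- s) zcoef adj e S1 x = 0].
Proof.
have nil_ok : (forall h, {in S0, h =1 g} -> weight S1 h != 0 ->
      exists y, piinv S1 S2 (dualvec S1 h) y) ->
    exists s : seq (vec T), [/\ uniq s, (forall x, x \in s <->
        (piinv S0 S1 (dualvec S0 g) x /\ ~ (exists y, piinv S1 S2 x y))) &
      \sum_(x <- s) zcoef adj e S1 x = 0].
  move=> all_ext; exists [::]; split=> //; last by rewrite big_nil.
  by move=> x; split=> // -[/fiber01P[h [-> hg w1]]] []; exact: all_ext.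
case: (boolP (u1 \in S0)) => [u1S0|u1S0].
  by apply: nil_ok => h; exact: fiber12_neq0_old.
have u1D : u1 \in D1 by rewrite inE u1S0.
(* The maximal exponent at [u] is either a natural number or negative. *)
case KE : (expo S0 g u + \sum_(w in D1) (((g u - 1) %/ - e w)%Z + 1)) => [K|K].
  pose s := [seq dualvec S1 (box_vec f) | f <- enum
    [pred f | (f \in nonext_box K) & weight S1 (@box_vec K f) != 0]].
  exists s; split.
  - rewrite map_inj_in_uniq ?enum_uniq // => f f'; rewrite !mem_enum !inE.
    move=> /andP[/(nonext_boxP u1D)[f0 _] _] /andP[/(nonext_boxP u1D)[f0' _] _].
    move=> /dualvecP ff; apply/ffunP => w.
    case: (boolP (w \in D1)) => [wD|wD]; last by rewrite f0 ?f0'.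
    have [wS _] := setDP wD; have := ff w wS.
    by rewrite /box_vec wD => /addrI/oppr_inj [/val_inj].
  - move=> x; split=> [/mapP[f]|[/fiber01P[h [-> hg w1]] nonext]].
      rewrite mem_enum inE => /andP[/(nonext_boxP u1D)[_ neg] w1] ->.
      have hg := box_vec_old f; split; first by apply/fiber01P; exists (box_vec f).
      by move/(fiber12_excess u1D hg w1); rewrite leNgt neg.
    have [f [fh f0]] := box_vec_surj u1D KE hg w1.
    apply/mapP; exists f; last by apply/esym/dualvecP.
    rewrite mem_enum inE (eq_weight _ _ fh) w1 andbT.
    apply/(nonext_boxP u1D); split=> //; rewrite fh // ltNge; apply/negP => ge0.
    by case: nonext; apply/(fiber12_excess u1D hg w1).
  - rewrite big_map big_enum /=.
    (* Putting back the box points of weight zero does not change the sum. *)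
    rewrite -[RHS](sum_nonext_box u1D KE) [RHS](bigID (fun f => weight S1 (box_vec f) != 0)) /=.
    rewrite [X in _ = _ + X]big1 ?addr0; last by move=> f /andP[_ /negPn/eqP].
    by apply: eq_big => [f|f _]; rewrite ?inE ?zcoef_dualvec.
(* A negative maximum leaves no point of nonzero weight over [S1], so the fiber is empty. *)
apply: nil_ok => h hg w1.
move: w1.
move=> /(weight_attach_neq0 e adjC sub01 uS val_u nb1 D1_gt0)[_ /andP[n0 _] leaf].
have : \sum_(w in D1) (h w + 1) <= \sum_(w in D1) (((g u - 1) %/ - e w)%Z + 1).
  by apply: ler_sum => w wD; rewrite lerD2r -leaf_ge0 ?e1 // -(hg u uS) leaf.
by move: n0 KE; rewrite (eq_expo _ _ _ hg); lia.
Qed.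

End Fibers.

Theorem mainTheorem7 (T : finType) (adj : rel T) (e : T -> int)
    (S0 S1 S2 : {set T}) (l : {ffun T -> rat}) :
  symmetric adj -> irreflexive adj ->
  elliptic adj e S0 -> elliptic adj e S1 -> elliptic adj e S2 ->
  attached adj S0 S1 -> attached adj S1 S2 ->
  Supp adj e S0 l ->
  (exists x, piinv adj e S0 S2 l x) ->
  exists s : seq {ffun T -> rat},
    [/\ uniq s,
        (forall l1, l1 \in s <->
           (piinv adj e S0 S1 l l1 /\ ~ (exists x, piinv adj e S1 S2 l1 x))) &
        \sum_(l1 <- s) zcoef adj e S1 l1 = 0].
Proof.
move=> adjC adjI ell0 ell1 ell2 [pr01 [u [uS val_u nb1]]].
move=> [pr12 [u1 [u1S val_u1 nb2]]] supp_l.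
have [g lE] := Supp_dualvecE supp_l; rewrite lE in supp_l *.
move=> ne_fiber.
exact: (nonext_sum adjC adjI ell0 ell1 ell2 pr01 uS val_u nb1 pr12 u1S val_u1
  nb2 supp_l ne_fiber).
Qed.
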